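(* Let $K$ be a convex body in $\mathbb{R}^n$ such that $\frac{1}{D}\mathbf{B}^n\subset K\subset\mathbf{B}^n$ for some $D>1$. Then the illumination number of $K$ is at most $$\mathrm{i}(K)\leq \frac{n\ln n+n\ln\ln n+5n}{\Omega_{n-1}(\alpha)},$$ where $\alpha=\arcsin(1/D)$.
   Context: A convex body in $\mathbb{R}^n$ is a compact convex set with non-empty interior. $\mathbf{B}^n$ denotes the closed Euclidean unit ball of $\mathbb{R}^n$ centered at the origin, and $\mathbb{S}^{n-1}$ its boundary sphere. A direction $u\in\mathbb{S}^{n-1}$ illuminates $K$ at a boundary point $b$ of $K$ if the ray $\{b+\lambda u : \lambda>0\}$ intersects the interior of $K$. The illumination number $\mathrm{i}(K)$ is the minimum number of directions such that each boundary point of $K$ is illuminated by at least one of them. For $u\in\mathbb{S}^{n-1}$ and $0<\varphi<\pi/2$, let $C(u,\varphi)=\{v\in\mathbb{S}^{n-1} : \sphericalangle(u,v)\leq\varphi\}$ be the spherical cap centered at $u$ of angular radius $\varphi$, where $\sphericalangle(u,v)$ is the angle between $u$ and $v$. $\Omega_{n-1}(\varphi)$ denotes the measure of $C(u,\varphi)$ (independent of $u$) with respect to the normalized Lebesgue measure on $\mathbb{S}^{n-1}$, i.e. the rotation-invariant (Haar) probability measure. *)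

(* Defs.v *)
From HB Require Import structures.
From mathcomp Require Import all_boot all_order all_algebra.
From mathcomp Require Import all_classical all_reals all_analysis.

Set Implicit Arguments.
Unset Strict Implicit.
Unset Printing Implicit Defensive.

Import Order.TTheory GRing.Theory Num.Theory.
Import numFieldNormedType.Exports.
Local Open Scope classical_set_scope.
Local Open Scope ring_scope.

Section EuclideanGeometry.
Context {R : realType} {n : nat}.
Implicit Types (u v x b : 'rV[R]_n) (K : set 'rV[R]_n).

Definition dotp u v : R := \sum_(i < n) u 0 i * v 0 i.

(* The library's norm on row vectors is the sup norm; the Euclidean one is
   defined here. Both induce the topology used for open, compact, interior. *)
Definition enorm x : R := Num.sqrt (dotp x x).

Definition eball (r : R) : set 'rV[R]_n := [set x | enorm x <= r].

Definition esphere : set 'rV[R]_n := [set x | enorm x = 1].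

(* For unit vectors only. *)
Definition angle u v : R := acos (dotp u v).

Definition cap u (phi : R) : set 'rV[R]_n :=
  [set v | esphere v /\ angle u v <= phi].

Definition convex_body K : Prop :=
  [/\ compact K,
      convex_set (K : set (convex_lmodType 'rV[R]_n)) &
      interior K !=set0].

Definition boundary K : set 'rV[R]_n := closure K `\` interior K.

Definition illuminates K u b : Prop :=
  exists2 lambda : R, 0 < lambda & interior K (b + lambda *: u).

(* A k-tuple of directions may have repetitions; this does not affect the
   minimum. The value is +oo if no finite family of directions illuminates K. *)
Definition illumination_number K : \bar R :=
  ereal_inf [set k%:R%:E | k in [set k : nat |
    exists2 u : 'I_k -> 'rV[R]_n, (forall i, esphere (u i)) &
      forall b, boundary K b -> exists i, illuminates K (u i) b]].

Definition rotation (Q : 'M[R]_n) : Prop := Q *m Q^T = 1%:M /\ \det Q = 1.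

End EuclideanGeometry.

Notation borelRn R n := (g_sigma_algebraType (@open 'rV[R]_n)).

Section SphericalMeasure.
Context {R : realType} {n : nat}.

(* The Haar probability measure of the unit sphere, as a Borel measure on the
   ambient space concentrated on the sphere. For 2 <= n there is exactly one,
   the normalized Lebesgue (surface) measure. *)
Definition sphere_haar (sigma : probability (borelRn R n) R) : Prop :=
  sigma (@esphere R n) = 1%E /\
  forall (Q : 'M[R]_n) (A : set (borelRn R n)), rotation Q -> measurable A ->
    sigma [set x : 'rV[R]_n | A (x *m Q)] = sigma A.

(* The center u of the cap is kept as an argument; by rotation invariance the
   value does not depend on it. *)
Definition Omega (sigma : probability (borelRn R n) R) (u : 'rV[R]_n)
  (phi : R) : R := fine (sigma (cap u phi)).

End SphericalMeasure.

(* Main.v *)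
Require Import Defs.
From mathcomp Require Import all_boot all_order all_algebra.
From mathcomp Require Import all_classical all_reals all_analysis.
From mathcomp Require Import measurable_realfun ring lra.

Set Implicit Arguments.
Unset Strict Implicit.
Unset Printing Implicit Defensive.

Import Order.TTheory GRing.Theory Num.Theory.
Import numFieldNormedType.Exports.
Local Open Scope classical_set_scope.
Local Open Scope ring_scope.

(** Illuminating a boundary point [b] of [K] reduces to covering the sphere by
    caps. As [b] lies in the unit ball and the ball of radius [1 / D] in [K], each
    direction at angle less than [alpha = arcsin (1 / D)] from [- b / |b|] meets
    the interior of that ball ([illuminates_cap]). So it suffices that every point
    of the sphere is at angle less than [alpha] from one of the chosen directions.

    Few such directions are found by the method of Rogers ([sphere_covering]).
    Caps of a slightly smaller radius are placed greedily, each taking an average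
    share of what is left, until the uncovered mass is tiny; the remainder is
    filled by a maximal [alpha]-separated family, around which small disjoint
    caps must fit into the uncovered set. The number of directions is optimised in
    [covering_parameters].

    The count rests on the comparison of the masses of caps of different radii:
    [Omega (kappa * alpha)] is about [kappa ^ n * Omega alpha] or more. The Haar
    measure is known only through its invariance, so no integral formula for the
    mass of a cap is used. Instead caps are compared through packings. A maximal
    [r]-separated family has at least as many points within [r] of a cap as any
    competing [r]-separated family has in the cap, since otherwise the competing
    points could be substituted for them ([packing_exchange]). A competing
    family is obtained by shrinking, towards the centre of the cap, the points of
    a coarser packing in a larger cap, and shrinking by a factor [t] divides
    angles by at most [t], because [cos (s * acos y)] is concave
    in [y] for [0 <= s <= 1] ([spherical_dilation]). The coarser packing has at
    least its average number of points in some cap, hence, after a rotation, in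
    the given one. The ratio of the sizes of the two packings is at most about
    [t ^ n] at suitable scales, because packing numbers grow polynomially
    ([packing_growth]). So the points of a fine packing serve as a finite set of
    candidate centres, evenly spread in the sense of [packing_cap_count], and the
    greedy step is an average over them ([greedy_cap]). *)

(** * Concavity of cos (s acos y) and contractions of spherical triangles *)
Section Trigonometry.
Context {R : realType}.
Implicit Types (a b s x y c : R).

Lemma is_derive_scale s x : is_derive x 1 (fun y : R => s * y) s.
Proof.
have -> : (fun y : R => s * y) = s \*: (@idfun R) by [].
by apply: is_derive_eq; rewrite [_ *: _]mulr1.
Qed.

Lemma is_derive_sin_scale s x :
  is_derive x 1 (fun y => sin (s * y)) (s * cos (s * x)).
Proof.
rewrite mulrC; apply: (is_derive1_comp (f := sin) (g := fun y => s * y)).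
exact: is_derive_scale.
Qed.

Lemma is_derive_cos_scale s x :
  is_derive x 1 (fun y => cos (s * y)) (- (s * sin (s * x))).
Proof.
rewrite -mulrN mulrC; apply: (is_derive1_comp (f := cos) (g := fun y => s * y)).
exact: is_derive_scale.
Qed.

Lemma MVT_on (f df : R -> R) a b : a <= b ->
  (forall x, a <= x <= b -> is_derive x 1 f (df x)) ->
  exists2 c, a <= c <= b & f b - f a = df c * (b - a).
Proof.
move=> ab h; have [||c] := @MVT_segment R f df a b ab.
- by move=> x; rewrite in_itv /= => /andP[ax xb]; apply: h; rewrite !ltW.
- apply: continuous_in_subspaceT => x; rewrite inE /= in_itv /= => xab.
  apply: differentiable_continuous; apply/derivable1_diffP.
  by have [] := h _ xab.
- by rewrite in_itv /= => ? ?; exists c.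
Qed.

Lemma sin_scale_ge0 s x : 0 <= s <= 1 -> 0 <= x <= pi -> 0 <= sin (s * x).
Proof. by move=> hs hx; apply: sin_ge0_pi; nra. Qed.

(** This is the sign of the derivative of [sin (s * x) / sin x], cleared of its
    denominator so that it holds up to the endpoints; the difference of the two
    sides vanishes at 0 and has derivative
    [(1 - s ^+ 2) * (sin (s * x) * sin x)]. *)
Lemma sin_scale_cos_le s x : 0 <= s <= 1 -> 0 <= x <= pi ->
  sin (s * x) * cos x <= s * (cos (s * x) * sin x).
Proof.
move=> hs /andP[x0 xpi].
pose q y := s * (cos (s * y) * sin y) - sin (s * y) * cos y.
have dq y : is_derive y 1 q ((1 - s ^+ 2) * (sin (s * y) * sin y)).
  have h1 := is_derive_sin_scale s y; have h2 := is_derive_cos_scale s y.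
  rewrite /q; apply: is_derive_eq.
  by rewrite /GRing.scale /=; ring.
have [z /andP[z0 zx] qE] := MVT_on x0 (fun y _ => dq y).
have q0 : q 0 = 0 by rewrite /q mulr0 sin0 !mulr0 mul0r subr0.
suff : 0 <= q x - q 0 by rewrite q0 subr0 subr_ge0.
rewrite qE.
have z1 : 0 <= z <= pi by rewrite z0 (le_trans zx).
have s0 := sin_scale_ge0 hs z1; have s1 := sin_ge0_pi z1.
by rewrite subr0 !mulr_ge0//; nra.
Qed.

Lemma sin_scale_ratio s a b : 0 <= s <= 1 -> 0 < a -> a <= b -> b < pi ->
  sin (s * a) / sin a <= sin (s * b) / sin b.
Proof.
move=> hs a0 ab bpi.
pose df x := (s * (cos (s * x) * sin x) - sin (s * x) * cos x) / sin x ^+ 2.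
have sp x : a <= x <= b -> 0 < sin x.
  by move=> /andP[ax xb]; apply: sin_gt0_pi; lra.
have [x xab|z zab E] := @MVT_on (fun x => sin (s * x) / sin x) df a b ab.
  have sx := lt0r_neq0 (sp _ xab).
  have h1 := is_derive_sin_scale s x.
  have h2 : is_derive x 1 (fun x : R => (sin x)^-1) (- (sin x) ^- 2 *: cos x).
    exact: is_deriveV.
  apply: is_derive_eq.
  by rewrite /df /GRing.scale /=; field.
rewrite -subr_ge0 E mulr_ge0 ?subr_ge0// divr_ge0 ?sqr_ge0// subr_ge0.
by apply: sin_scale_cos_le => //; lra.
Qed.

(** The function [y |-> cos (s * acos y)] is concave on [-1, 1]: its slope at
    [y = cos c] is [s * (sin (s * c) / sin c)], which increases with [c], hence
    decreases with [y]. The inequality puts its graph below its tangent. *)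
Lemma cos_scale_tangent s c x : 0 <= s <= 1 -> 0 < c < pi -> 0 <= x <= pi ->
  cos (s * x) <= cos (s * c) + s * (sin (s * c) / sin c) * (cos x - cos c).
Proof.
move=> hs hc hx; set k := sin (s * c) / sin c.
pose g y := cos (s * y) - s * k * cos y.
have dg y : is_derive y 1 g (s * (k * sin y - sin (s * y))).
  have h2 := is_derive_cos_scale s y.
  rewrite /g; apply: is_derive_eq.
  by rewrite /GRing.scale /=; ring.
suff : g x <= g c by rewrite /g; lra.
have [xc|cx] := leP x c.
  have [z hz E] := MVT_on xc (fun y _ => dg y).
  rewrite -subr_ge0 E; apply: mulr_ge0; last lra.
  apply: mulr_ge0; first lra.
  have [->|z0] := eqVneq z 0; first by rewrite mulr0 sin0 mulr0 subr0.
  have zp : 0 < z by rewrite lt_neqAle eq_sym z0; lra.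
  have sz : 0 < sin z by apply: sin_gt0_pi; lra.
  have h : sin (s * z) / sin z <= k by apply: sin_scale_ratio => //; lra.
  by rewrite subr_ge0 -ler_pdivrMr.
have [z hz E] := MVT_on (ltW cx) (fun y _ => dg y).
rewrite -subr_le0 E; apply: mulr_le0_ge0; last lra.
apply: mulr_ge0_le0; first lra.
have [->|z0] := eqVneq z pi.
  rewrite sinpi mulr0 sub0r oppr_le0; apply: sin_scale_ge0 => //.
  by rewrite pi_ge0 lexx.
have zp : z < pi by rewrite lt_neqAle z0; lra.
have sz : 0 < sin z by apply: sin_gt0_pi; lra.
have h : k <= sin (s * z) / sin z by apply: sin_scale_ratio => //; lra.
by rewrite subr_le0 -ler_pdivlMr.
Qed.

(** Comparison of two spherical triangles with the same angle at one vertex, the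
    adjacent sides being [a], [b] in one and [s * a], [s * b] in the other: the
    side opposite to that vertex shrinks by a factor at least [s]. By the
    spherical law of cosines the cosine of that side is [cos a * cos b + D] with
    [D = sin a * sin b * k], [k] the cosine of the angle, that is
    [(1 + k) / 2 * cos (a - b) + (1 - k) / 2 * cos (a + b)]. The same weights
    express the smaller triangle, so the claim is the concavity of
    [y |-> cos (s * acos y)], used at [cos (a - b)] and [cos (a + b)].
    The bounds by [pi / 2] keep [a + b] below [pi], where the tangent exists. *)
Lemma spherical_dilation s a b D : 0 <= s <= 1 ->
  0 <= a < pi / 2 -> 0 <= b < pi / 2 -> `|D| <= sin a * sin b ->
  cos (s * a) * cos (s * b) + sin (s * a) / sin a * (sin (s * b) / sin b) * D
    <= cos (s * acos (cos a * cos b + D)).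
Proof.
move=> hs ha hb hD.
have pi0 := @pi_gt0 R.
have sa0 : 0 <= sin a by apply: sin_ge0_pi; lra.
have sb0 : 0 <= sin b by apply: sin_ge0_pi; lra.
have [k kD hk] : exists2 k, D = k * (sin a * sin b) & -1 <= k <= 1.
  (* in a degenerate triangle D vanishes and any angle will do *)
  have [E|NE] := eqVneq (sin a * sin b) 0.
    by exists 0; [apply/eqP; rewrite mul0r -normr_le0 -E|rewrite lerN10 ler01].
  exists (D / (sin a * sin b)); first by rewrite divfK.
  rewrite -ler_norml normrM normfV (ger0_norm (mulr_ge0 sa0 sb0)) ler_pdivrMr ?mul1r//.
  by rewrite lt_def NE mulr_ge0.
set c := acos _.
have E : cos a * cos b + D = (1 + k) / 2 * cos (a - b) + (1 - k) / 2 * cos (a + b).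
  by rewrite kD cosB cosD; lra.
have clo : -1 < cos (a + b).
  rewrite -cospi ltr_cos ?in_itv /=; lra.
have c1 : cos (a - b) <= 1 := cos_le1 _.
have c2 : cos (a + b) <= 1 := cos_le1 _.
have c3 : cos (a + b) <= cos (a - b).
  by rewrite cosB cosD; have := mulr_ge0 sa0 sb0; lra.
have hc : -1 < cos a * cos b + D <= 1 by rewrite E; nra.
have cosc : cos c = cos a * cos b + D.
  by rewrite acosK// in_itv /=; lra.
have lhs : cos (s * a) * cos (s * b) +
    sin (s * a) / sin a * (sin (s * b) / sin b) * D <=
    (1 + k) / 2 * cos (s * (a - b)) + (1 - k) / 2 * cos (s * (a + b)).
  rewrite mulrBr mulrDr cosB cosD.
  suff -> : sin (s * a) / sin a * (sin (s * b) / sin b) * D =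
       sin (s * a) * sin (s * b) * k by lra.
  rewrite kD; have z0 (z : R) : 0 <= z < pi / 2 -> sin z = 0 -> sin (s * z) = 0.
    move=> hz sz; have [->|zN0] := eqVneq z 0; first by rewrite mulr0 sin0.
    have : 0 < sin z by apply: sin_gt0_pi; rewrite lt_def zN0; lra.
    by rewrite sz ltxx.
  have [/z0 ->//|sa] := eqVneq (sin a) 0; first by rewrite !mul0r.
  have [/z0 ->//|sb] := eqVneq (sin b) 0; first by rewrite mul0r !mulr0 !mul0r.
  by field; rewrite sa sb.
apply: le_trans lhs _.
have cge0 : 0 <= c by apply: acos_ge0; lra.
have clt : c < pi by apply: acos_ltpi.
have [c0|cN0] := eqVneq c 0.
  rewrite c0 mulr0 cos0.
  have := cos_le1 (s * (a - b)); have := cos_le1 (s * (a + b)); nra.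
have cpos : 0 < c by rewrite lt_def cN0.
have t1 : cos (s * (a + b)) <=
    cos (s * c) + s * (sin (s * c) / sin c) * (cos (a + b) - cos c).
  by apply: cos_scale_tangent => //; lra.
have t2 : cos (s * (a - b)) <=
    cos (s * c) + s * (sin (s * c) / sin c) * (cos (a - b) - cos c).
  rewrite -(cos_norm (a - b)) -(cos_norm (s * (a - b))) normrM ger0_norm; last lra.
  apply: cos_scale_tangent => //; first lra.
  by rewrite normr_ge0 ler_norml; lra.
move: t1 t2; rewrite cosc E.
set T := s * _; set C1 := cos (a + b); set C2 := cos (a - b).
set X := cos _; set Y := cos _; set Z := cos _ => t1 t2.
nra.
Qed.

End Trigonometry.

(** * The Euclidean dot product *)
Section DotProduct.
Context {R : realType} {n : nat}.
Implicit Types (u v w x y z p : 'rV[R]_n) (r s c : R).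

Lemma dotpE u v : dotp u v = (u *m v^T) 0 0.
Proof. by rewrite mxE; apply: eq_bigr => i _; rewrite mxE. Qed.

Lemma dotpC u v : dotp u v = dotp v u.
Proof. by apply: eq_bigr => i _; rewrite mulrC. Qed.

Lemma dotpDl u v w : dotp (u + v) w = dotp u w + dotp v w.
Proof. by rewrite !dotpE mulmxDl mxE. Qed.

Lemma dotpZl c u w : dotp (c *: u) w = c * dotp u w.
Proof. by rewrite !dotpE -scalemxAl mxE. Qed.

Lemma dotpNl u w : dotp (- u) w = - dotp u w.
Proof. by rewrite !dotpE mulNmx mxE. Qed.

Lemma dotpDr u v w : dotp w (u + v) = dotp w u + dotp w v.
Proof. by rewrite dotpC dotpDl !(dotpC w). Qed.

Lemma dotpZr c u w : dotp w (c *: u) = c * dotp w u.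
Proof. by rewrite dotpC dotpZl (dotpC w). Qed.

Lemma dotpNr u w : dotp w (- u) = - dotp w u.
Proof. by rewrite dotpC dotpNl (dotpC w). Qed.

Definition dotp_lin := (dotpDl, dotpDr, dotpNl, dotpNr, dotpZl, dotpZr).

Lemma dotp_ge0 u : 0 <= dotp u u.
Proof. by apply: sumr_ge0 => i _; rewrite -expr2 sqr_ge0. Qed.

Lemma dotp_eq0 u : (dotp u u == 0) = (u == 0).
Proof.
apply/idP/eqP => [|->]; last by rewrite -(scale0r 0) dotpZl mul0r.
rewrite psumr_eq0 => [/allP h|i _]; last by rewrite -expr2 sqr_ge0.
apply/rowP => i; rewrite mxE; apply/eqP; rewrite -sqrf_eq0 expr2.
by apply: h; rewrite mem_index_enum.
Qed.

Lemma dotp_gt0 u : u != 0 -> 0 < dotp u u.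
Proof. by move=> u0; rewrite lt_def dotp_eq0 u0 dotp_ge0. Qed.

Lemma dotp_sqr_le u v : dotp u v ^+ 2 <= dotp u u * dotp v v.
Proof.
have [->|v0] := eqVneq v 0.
  by rewrite -(scale0r 0) !dotpZr !mul0r mulr0 expr0n.
have vv := dotp_gt0 v0.
have := dotp_ge0 (dotp v v *: u - dotp u v *: v).
rewrite !dotp_lin (dotpC v u).
set a := dotp u u; set b := dotp v v in vv *; set c := dotp u v => h.
have : 0 <= b * (a * b - c ^+ 2) by move: h; congr (_ <= _); ring.
by rewrite pmulr_rge0// subr_ge0.
Qed.

Lemma esphereP u : esphere u <-> dotp u u = 1.
Proof.
rewrite /esphere /= /enorm; split => [h|->]; last exact: sqrtr1.
by rewrite -[LHS]sqr_sqrtr ?dotp_ge0// h expr1n.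
Qed.

Lemma dotp_itv u v : esphere u -> esphere v -> -1 <= dotp u v <= 1.
Proof.
move=> /esphereP u1 /esphereP v1; rewrite -ler_norml -[leRHS]normr1 -ler_sqr ?nnegrE//.
by rewrite !real_normK ?num_real// (le_trans (dotp_sqr_le _ _))// u1 v1 mulr1 expr1n.
Qed.

Lemma normalize_esphere u : u != 0 -> esphere ((Num.sqrt (dotp u u))^-1 *: u).
Proof.
move=> u0; apply/esphereP; rewrite !dotp_lin mulrA -expr2 exprVn sqr_sqrtr ?dotp_ge0//.
by rewrite mulVf// dotp_eq0.
Qed.

End DotProduct.

(** * The angular metric of the sphere *)
Section Angle.
Context {R : realType} {n : nat}.
Implicit Types (u v w x y z p : 'rV[R]_n) (r s c phi : R).

Lemma angleC u v : angle u v = angle v u.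
Proof. by rewrite /angle dotpC. Qed.

Lemma angle_itv u v : esphere u -> esphere v -> 0 <= angle u v <= pi.
Proof.
by move=> hu hv; rewrite acos_ge0 ?acos_lepi//; apply: dotp_itv.
Qed.

Lemma cos_angle u v : esphere u -> esphere v -> cos (angle u v) = dotp u v.
Proof. by move=> hu hv; rewrite acosK// in_itv /= dotp_itv. Qed.

Lemma angle_ge u v c : esphere u -> esphere v -> 0 <= c <= pi ->
  (c <= angle u v) = (dotp u v <= cos c).
Proof.
move=> hu hv hc; rewrite -cos_angle// !leNgt ltr_cos// in_itv/= ?angle_itv//.
Qed.

Lemma angle_le u v c : esphere u -> esphere v -> 0 <= c <= pi ->
  (angle u v <= c) = (cos c <= dotp u v).
Proof.
move=> hu hv hc; rewrite -cos_angle// !leNgt ltr_cos// in_itv/= ?angle_itv//.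
Qed.

Definition orth p x := x - dotp p x *: p.

Lemma dotp_orth p x y : esphere p ->
  dotp (orth p x) (orth p y) = dotp x y - dotp p x * dotp p y.
Proof.
move=> /esphereP p1; rewrite /orth !dotp_lin p1 (dotpC x p); ring.
Qed.

Lemma dotp_orthr p x : esphere p -> dotp p (orth p x) = 0.
Proof. by move=> /esphereP p1; rewrite /orth !dotp_lin p1 mulr1 subrr. Qed.

Lemma sin_angle_ge0 p x : esphere p -> esphere x -> 0 <= sin (angle p x).
Proof. by move=> hp hx; apply: sin_ge0_pi; apply: angle_itv. Qed.

Lemma dotp_orth_self p x : esphere p -> esphere x ->
  dotp (orth p x) (orth p x) = sin (angle p x) ^+ 2.
Proof.
move=> hp hx; rewrite dotp_orth// sin2cos2 cos_angle//.
by move/esphereP : hx => ->; rewrite expr2.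
Qed.

Lemma norm_dotp_orth p x y : esphere p -> esphere x -> esphere y ->
  `|dotp x y - dotp p x * dotp p y| <= sin (angle p x) * sin (angle p y).
Proof.
move=> hp hx hy; rewrite -dotp_orth//.
have h := mulr_ge0 (sin_angle_ge0 hp hx) (sin_angle_ge0 hp hy).
rewrite -(ger0_norm h) -ler_sqr ?nnegrE// !real_normK ?num_real//.
by rewrite exprMn -!dotp_orth_self// dotp_sqr_le.
Qed.

(** [cos (a + b) = cos a * cos b - sin a * sin b], and the product of the sines
    bounds the contribution of the components orthogonal to [p]. *)
Lemma angle_triangle p x y : esphere p -> esphere x -> esphere y ->
  angle x y <= angle p x + angle p y.
Proof.
move=> hp hx hy.
have hpx := angle_itv hp hx; have hpy := angle_itv hp hy.
have hxy := angle_itv hx hy.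
have [hpi|hpi] := leP (angle p x + angle p y) pi; last lra.
rewrite angle_le//; last lra.
rewrite cosD !cos_angle//; have := norm_dotp_orth hp hx hy.
rewrite ler_norml; lra.
Qed.

(** The point at angle [s * angle p x] from [p] on the great circle arc from [p]
    to [x]. At [x = p] the quotient of sines is the junk value [0 / 0 = 0], which
    is harmless as [orth p p = 0]. *)
Definition shrink s p x :=
  cos (s * angle p x) *: p + (sin (s * angle p x) / sin (angle p x)) *: orth p x.

Lemma dotp_shrink s p x y : esphere p ->
  dotp (shrink s p x) (shrink s p y) =
  cos (s * angle p x) * cos (s * angle p y) +
  sin (s * angle p x) / sin (angle p x) * (sin (s * angle p y) / sin (angle p y))
   * (dotp x y - dotp p x * dotp p y).
Proof.
move=> hp; rewrite -dotp_orth// /shrink.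
move: (orth p x) (orth p y) (dotp_orthr x hp) (dotp_orthr y hp) => ox oy px py.
rewrite !dotp_lin (dotpC ox p) px py.
by move/esphereP: hp => ->; ring.
Qed.

Lemma sin_angle_eq0 s p x : esphere p -> esphere x -> angle p x < pi / 2 ->
  sin (angle p x) = 0 -> angle p x = 0.
Proof.
move=> hp hx h s0; apply: contrapT => /eqP a0.
have : 0 < sin (angle p x).
  apply: sin_gt0_pi; have := @pi_gt0 R; have := angle_itv hp hx.
  by rewrite le_eqVlt eq_sym (negPf a0)/=; lra.
by rewrite s0 ltxx.
Qed.

Lemma shrink_esphere s p x : esphere p -> esphere x -> angle p x < pi / 2 ->
  esphere (shrink s p x).
Proof.
move=> hp hx h; apply/esphereP; rewrite dotp_shrink// -dotp_orth//.
rewrite dotp_orth_self//.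
have [s0|s0] := eqVneq (sin (angle p x)) 0.
  by rewrite (sin_angle_eq0 s hp hx h s0) mulr0 cos0 sin0 !mul0r addr0 mulr1.
rewrite -[RHS](cos2Dsin2 (s * angle p x)); by field.
Qed.

Lemma angle_shrink s p x : 0 <= s <= 1 -> esphere p -> esphere x ->
  angle p x < pi / 2 -> angle p (shrink s p x) = s * angle p x.
Proof.
move=> hs hp hx h.
have -> : angle p (shrink s p x) = acos (cos (s * angle p x)).
  congr acos; rewrite /shrink; move: (orth p x) (dotp_orthr x hp) => ox px.
  rewrite !dotp_lin px.
  by move/esphereP: hp => ->; ring.
by rewrite cosK// in_itv /=; have := angle_itv hp hx; nra.
Qed.

(** Shrinking towards [p] divides angles by at most [s^-1]: an [r]-separated
    family becomes an [s * r]-separated one. *)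
Lemma angle_shrink_ge s p x y : 0 <= s <= 1 -> esphere p -> esphere x ->
  esphere y -> angle p x < pi / 2 -> angle p y < pi / 2 ->
  s * angle x y <= angle (shrink s p x) (shrink s p y).
Proof.
move=> hs hp hx hy ax ay; have axy := angle_itv hx hy.
rewrite angle_ge; [|exact: shrink_esphere..|nra].
have /andP[hpx _] := angle_itv hp hx; have /andP[hpy _] := angle_itv hp hy.
have := @spherical_dilation R s (angle p x) (angle p y) _ hs _ _
  (norm_dotp_orth hp hx hy).
rewrite hpx hpy dotp_shrink// !cos_angle// => /(_ ax ay) /le_trans; apply.
by rewrite addrC subrK.
Qed.

End Angle.

(** * Transitivity of the rotation group *)
Section Rotations.
Context {R : realType} {n : nat}.
Implicit Types (u v w x y z p q : 'rV[R]_n) (Q : 'M[R]_n).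

Lemma dotp_rotation Q x y : rotation Q -> dotp (x *m Q) (y *m Q) = dotp x y.
Proof.
by move=> [QQ _]; rewrite !dotpE trmx_mul mulmxA -(mulmxA x) QQ mulmx1.
Qed.

Lemma rotation_esphere Q x : rotation Q -> esphere x -> esphere (x *m Q).
Proof. by move=> hQ /esphereP hx; apply/esphereP; rewrite dotp_rotation. Qed.

Definition refl w : 'M[R]_n := 1%:M - 2 *: (w^T *m w).

Lemma mul_refl x w : x *m refl w = x - (2 * dotp x w) *: w.
Proof.
rewrite /refl mulmxBr mulmx1 -scalemxAr mulmxA; congr (_ - _).
have -> : x *m w^T = (dotp x w)%:M by rewrite [LHS]mx11_scalar dotpE.
by rewrite mul_scalar_mx scalerA.
Qed.

Lemma refl_sym w : (refl w)^T = refl w.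
Proof. by rewrite /refl linearB /= trmx1 linearZ /= trmx_mul trmxK. Qed.

Lemma reflK w : esphere w -> refl w *m refl w = 1%:M.
Proof.
move=> /esphereP hw; apply/row_matrixP => i; rewrite !rowE mulmxA mulmx1.
move: (delta_mx _ _) => x; rewrite !mul_refl !dotp_lin hw mulr1.
rewrite -addrA -opprD -scalerDl.
have -> : 2 * dotp x w + 2 * (dotp x w - 2 * dotp x w) = 0 by ring.
by rewrite scale0r subr0.
Qed.

Lemma det_refl_sqr w : esphere w -> \det (refl w) * \det (refl w) = 1.
Proof. by move=> hw; rewrite -det_mulmx reflK// det1. Qed.

Lemma refl_swap u v : esphere u -> esphere v -> u != v ->
  exists2 w, esphere w & u *m refl w = v.
Proof.
move=> /esphereP hu /esphereP hv uv.
have d0 : u - v != 0 by rewrite subr_eq0.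
exists ((Num.sqrt (dotp (u - v) (u - v)))^-1 *: (u - v)).
  exact: normalize_esphere.
rewrite mul_refl; have := dotp_gt0 d0.
set N := Num.sqrt _ => dd.
have NN : N * N = 2 - 2 * dotp u v.
  by rewrite -expr2 sqr_sqrtr ?dotp_ge0// !dotp_lin hu hv (dotpC v u); ring.
have N0 : N != 0 by rewrite gt_eqF// sqrtr_gt0.
rewrite scalerA.
have -> : 2 * dotp u (N^-1 *: (u - v)) * N^-1 = 1.
  rewrite !dotp_lin hu; have -> : 1 - dotp u v = N * N / 2 by rewrite NN; field.
  by field.
by rewrite scale1r opprB addrC subrK.
Qed.

(** The reflection exchanging two unit vectors conjugates the corresponding
    reflections. So the value [-1] of the determinant need not be computed to see
    that a product of two reflections has determinant 1. *)
Lemma det_refl_const w1 w2 : esphere w1 -> esphere w2 ->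
  \det (refl w1) = \det (refl w2).
Proof.
move=> h1 h2; have [->//|/(refl_swap h1 h2)[w hw E]] := eqVneq w1 w2.
have -> : refl w2 = refl w *m refl w1 *m refl w.
  rewrite -E; move: (refl w) (refl_sym w) (reflK hw) => P Pt PP.
  rewrite /refl trmx_mul Pt mulmxBr mulmx1 mulmxBl PP.
  by rewrite -scalemxAr -scalemxAl !mulmxA.
by rewrite !det_mulmx mulrC mulrA det_refl_sqr// mul1r.
Qed.

Lemma orthogonal_unit v : (2 <= n)%N -> exists2 w, esphere w & dotp v w = 0.
Proof.
move=> n2; pose i0 := Ordinal (ltnW n2); pose i1 := Ordinal n2.
have dd x i : dotp x (delta_mx 0 i) = x 0 i.
  rewrite /dotp (bigD1 i)//= big1 => [|j ji].
    by rewrite mxE !eqxx mulr1 addr0.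
  by rewrite mxE (negPf ji) andbF mulr0.
suff [w w0 vw] : exists2 w, w != 0 & dotp v w = 0.
  exists ((Num.sqrt (dotp w w))^-1 *: w); first exact: normalize_esphere.
  by rewrite dotpZr vw mulr0.
have e0 : (delta_mx 0 i0 : 'rV[R]_n) != 0.
  by apply/eqP => /rowP /(_ i0) /eqP; rewrite !mxE !eqxx oner_eq0.
have [v0|v0] := eqVneq (v 0 i0) 0.
  by exists (delta_mx 0 i0) => //; rewrite dd.
exists (v 0 i1 *: delta_mx 0 i0 - v 0 i0 *: delta_mx 0 i1).
  apply/eqP => /rowP /(_ i1) /eqP; rewrite !mxE !eqxx /=.
  by rewrite mulr0 mulr1 sub0r oppr_eq0 (negPf v0).
by rewrite !dotp_lin !dd mulrC subrr.
Qed.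

(** A single reflection takes [p] to [q]; composing it with a reflection that
    fixes [q], which exists in dimension at least 2, restores the orientation. *)
Lemma rotation_transitive p q : (2 <= n)%N -> esphere p -> esphere q ->
  exists2 Q : 'M[R]_n, rotation Q & p *m Q = q.
Proof.
move=> n2 hp hq; have [->|/(refl_swap hp hq)[w hw E]] := eqVneq p q.
  by exists 1%:M; [split; rewrite ?trmx1 ?mulmx1 ?det1|rewrite mulmx1].
have [z hz qz] := orthogonal_unit q n2.
exists (refl w *m refl z); last first.
  by rewrite mulmxA E mul_refl qz mulr0 scale0r subr0.
split; last by rewrite det_mulmx (det_refl_const hw hz) det_refl_sqr.
rewrite trmx_mul !refl_sym mulmxA -(mulmxA (refl w)) reflK// mulmx1.
exact: reflK.
Qed.

End Rotations.

(** * Size of separated families *)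
Section Packing.
Context {R : realType} {n : nat}.
Implicit Types (u v w x y z p : 'rV[R]_n) (r q t h : R) (A : set 'rV[R]_n)
  (s : seq 'rV[R]_n).

Lemma bernoulli_ineq h k : -1 <= h -> 1 + k%:R * h <= (1 + h) ^+ k.
Proof.
move=> h1; elim: k => [|k IH]; first by rewrite mul0r addr0 expr0.
rewrite exprS; apply: le_trans (ler_wpM2l _ IH); last lra.
rewrite -natr1; have : 0 <= k%:R :> R by []; have := sqr_ge0 h; rewrite expr2; nra.
Qed.

(** The square of the chord of an arc [r] is [2 - 2 * cos r], so this bounds small
    arcs by a multiple of their chords. *)
Lemma one_sub_cos_ge r : 0 <= r <= 2^-1 -> r ^+ 2 / 4 <= 1 - cos r.
Proof.
move=> /andP[r0 r1].
have sin_le (x : R) : 0 <= x -> sin x <= x.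
  move=> x0; have [c _] := MVT_on x0 (fun (y : R) _ => is_derive_sin y).
  by rewrite sin0 !subr0 => ->; have := cos_le1 c; nra.
have cos_ge (x : R) : 0 <= x <= 2^-1 -> 3 / 4 <= cos x.
  move=> /andP[x0 x1].
  have [c /andP[c0 c1]] := MVT_on x0 (fun (y : R) _ => is_derive_cos y).
  by rewrite cos0 subr0; have := sin_le _ c0; nra.
have sin_ge (x : R) : 0 <= x <= 2^-1 -> x / 2 <= sin x.
  move=> /andP[x0 x1].
  have [c /andP[c0 c1]] := MVT_on x0 (fun (y : R) _ => is_derive_sin y).
  rewrite sin0 !subr0 => ->; have := cos_ge c.
  by rewrite c0 (le_trans c1 x1) => /(_ isT); nra.
pose g (x : R) := 1 - cos x - x ^+ 2 / 4.
have dg (x : R) : is_derive x 1 g (sin x - x / 2).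
  rewrite /g; apply: is_derive_eq; rewrite /GRing.scale /=; lra.
have [c /andP[c0 c1]] := MVT_on r0 (fun (y : R) _ => dg y).
rewrite /g cos0 expr0n subr0 mul0r subr0.
have := sin_ge c; rewrite c0 (le_trans c1 r1) => /(_ isT); nra.
Qed.

Definition separated r A s :=
  {in s, forall x, A x} /\ pairwise (fun x y => r <= angle x y) s.

Lemma separated_sub r A B s : A `<=` B -> separated r A s -> separated r B s.
Proof. by move=> AB [sA ss]; split => // x /sA /AB. Qed.

Lemma separated_le r r' A s : r' <= r -> separated r A s -> separated r' A s.
Proof.
move=> rr' [sA ss]; split => //; apply: sub_pairwise ss => x y.
exact: le_trans.
Qed.

Lemma esphere_coord x i : esphere x -> -1 <= x 0 i <= 1.
Proof.
move=> /esphereP hx; rewrite -ler_norml -[leRHS]normr1 -ler_sqr ?nnegrE//.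
rewrite !real_normK ?num_real// expr1n -hx /dotp (bigD1 i)//= -expr2 lerDl.
by apply: sumr_ge0 => j _; rewrite -expr2 sqr_ge0.
Qed.

(** Cell of [x] in the division of the cube [-1, 1]^n into cubes of side
    [1 / m]; the coordinate 1 gets the extra index [2 * m]. *)
Definition grid_cell (m : nat) x : {ffun 'I_n -> 'I_(2 * m).+1} :=
  [ffun i => inord (Num.truncn ((x 0 i + 1) * m%:R))].

Lemma grid_cell_close m x y i : (0 < m)%N -> esphere x -> esphere y ->
  grid_cell m x = grid_cell m y -> (x 0 i - y 0 i) ^+ 2 <= m%:R^-1 ^+ 2.
Proof.
move=> m0 hx hy /ffunP /(_ i); rewrite !ffunE => /(congr1 val) /=.
have m0' : 0 < m%:R :> R by rewrite ltr0n.
have bnd z : esphere z -> 0 <= (z 0 i + 1) * m%:R <= (2 * m)%:R.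
  by move=> /(@esphere_coord _ i) hz; rewrite natrM; nra.
have bx := bnd _ hx; have by_ := bnd _ hy.
have tr (z : R) : 0 <= z <= (2 * m)%:R -> (Num.truncn z < (2 * m).+1)%N.
  move=> /andP[z0 z1]; rewrite ltnS -(ler_nat R).
  by apply: le_trans z1; rewrite truncn_le.
rewrite !inordK ?tr// => E.
have /andP[x1 x2] := truncn_itv (proj1 (andP bx)).
have /andP[y1 y2] := truncn_itv (proj1 (andP by_)).
rewrite E in x1 x2; rewrite -natr1 in x2 y2.
rewrite -(ler_pM2r (exprn_gt0 2 m0')) -!exprMn mulVf ?gt_eqF// expr1n.
have d : -1 <= (x 0 i - y 0 i) * m%:R <= 1 by rewrite mulrBl; lra.
by rewrite expr2; nra.
Qed.

(** Two points in the same grid cell are at Euclidean distance at most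
    [sqrt n / m], less than the chord of an arc [r]. *)
Lemma separated_size_grid m r s : (0 < m)%N -> 0 <= r <= pi ->
  n%:R * m%:R^-1 ^+ 2 < 2 - 2 * cos r -> separated r esphere s ->
  (size s <= (2 * m).+1 ^ n)%N.
Proof.
move=> m0 hr hm [sS ss].
have : uniq (map (grid_cell m) s).
  rewrite uniq_pairwise pairwise_map.
  apply: (sub_in_pairwise _ (allss s) ss) => x y xs ys /=.
  have hx := sS _ xs; have hy := sS _ ys.
  rewrite angle_ge// => xy; apply/eqP => E.
  have : 2 - 2 * dotp x y <= n%:R * m%:R^-1 ^+ 2.
    have -> : 2 - 2 * dotp x y = dotp (x - y) (x - y).
      rewrite !dotp_lin (dotpC y x); move/esphereP: hx => ->.
      by move/esphereP: hy => ->; ring.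
    rewrite -[n in n%:R]card_ord -sum1_card natr_sum mulr_suml.
    apply: ler_sum => i _; rewrite mul1r !mxE -expr2.
    exact: grid_cell_close.
  lra.
move/card_uniqP; rewrite size_map => <-.
by apply: leq_trans (max_card _) _; rewrite card_ffun !card_ord.
Qed.

(** Only the power of [r] matters: it is where the dimension enters the growth of
    packings. The exponent [n] is one more than the dimension of the sphere, which
    costs only lower order terms in the end. *)
Lemma separated_size_le r s : 0 < r <= 2^-1 -> separated r esphere s ->
  (size s)%:R <= ((4 * n%:R + 3) / r) ^+ n.
Proof.
move=> /andP[r0 r1] ss; have n0 : 0 <= n%:R :> R by [].
pose m := (Num.truncn (2 * n%:R / r)).+1.
have a0 : 0 <= 2 * n%:R / r by apply: divr_ge0; [apply: mulr_ge0|apply: ltW].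
have /andP[m1 m2] := truncn_itv a0; rewrite -/m in m2.
have mE : m%:R = (Num.truncn (2 * n%:R / r))%:R + 1 :> R by rewrite natr1.
have mpos : 0 < m%:R :> R by rewrite ltr0n.
have hr : 2 * n%:R < m%:R * r by rewrite -ltr_pdivrMr.
have mr : m%:R * r <= 2 * n%:R + r.
  by rewrite mE mulrDl mul1r lerD2r -ler_pdivlMr.
have ps := @pi_ge2 R.
have := @separated_size_grid m r s isT.
have -> : 0 <= r <= pi by lra.
move=> /(_ isT); have -> : n%:R * m%:R^-1 ^+ 2 < 2 - 2 * cos r.
  have h : r ^+ 2 / 4 <= 1 - cos r by apply: one_sub_cos_ge; lra.
  rewrite exprVn ltr_pdivrMr ?exprn_gt0//.
  have : r ^+ 2 / 2 * m%:R ^+ 2 <= (2 - 2 * cos r) * m%:R ^+ 2.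
    by rewrite ler_wpM2r ?sqr_ge0//; lra.
  apply: lt_le_trans; case: n n0 hr => [|k] n0 hr.
    by rewrite mulr_gt0 ?divr_gt0 ?exprn_gt0.
  have k1 : 1 <= k.+1%:R :> R by rewrite ler1n.
  rewrite -mulrAC -exprMn (mulrC r); nra.
move=> /(_ isT ss); rewrite -(ler_nat R) natrX => /le_trans; apply.
apply: lerXn2r; rewrite ?nnegrE// ?divr_ge0//; [lra..|].
rewrite ler_pdivlMr// -natr1 natrM; nra.
Qed.

End Packing.

(** * Maximal packings and their growth as the radius shrinks *)
Section MaximalSeparated.
Context {R : realType} {n : nat}.
Implicit Types (u v w x y z p : 'rV[R]_n) (r q t h : R) (A : set 'rV[R]_n)
  (s : seq 'rV[R]_n).

Definition max_separated r A s :=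
  separated r A s /\ forall s', separated r A s' -> (size s' <= size s)%N.

Lemma exists_max_separated r A : 0 < r -> A `<=` esphere ->
  exists s, max_separated r A s.
Proof.
move=> r0 AS; pose P k := `[< exists2 s, separated r A s & size s = k >].
pose r' := Num.min r 2^-1.
have exP : exists k, P k by exists 0%N; apply/asboolP; exists [::].
pose N := Num.truncn (((4 * n%:R + 3) / r') ^+ n).
have hr : 0 < r' <= 2^-1 by rewrite lt_min r0 invr_gt0 ltr0n ge_min lexx orbT.
have r'r : r' <= r by rewrite ge_min lexx.
have ubP k : P k -> (k <= N)%N.
  move=> /asboolP[s ss <-].
  have /(separated_size_le hr) h := separated_sub AS (separated_le r'r ss).
  by rewrite truncn_ge_nat// (le_trans _ h).
case: (ex_maxnP exP ubP) => k /asboolP[s ss <-] h.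
by exists s; split => // s' ss'; apply: h; apply/asboolP; exists s'.
Qed.

(** Otherwise [x] could be added to the family. *)
Lemma max_separated_cover r A s x : max_separated r A s -> A x ->
  exists2 y, y \in s & angle x y < r.
Proof.
move=> [[sA ss] smax] Ax; apply: contrapT => h.
suff : (size (x :: s) <= size s)%N by rewrite ltnn.
apply: smax; split => [y|]; first by rewrite inE => /predU1P[->|/sA].
rewrite /= ss andbT; apply/allP => y ys; rewrite leNgt; apply/negP => xy.
by apply: h; exists y.
Qed.

Definition packing r : seq 'rV[R]_n := xget [::] [set s | max_separated r esphere s].

Lemma packingP r : 0 < r -> max_separated r esphere (packing r).
Proof. by move=> r0; apply: xgetPex; apply: exists_max_separated. Qed.

Lemma packing_gt0 r p : 0 < r -> esphere p -> (0 < size (packing r))%N.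
Proof.
move=> r0 hp; have [y ys _] := max_separated_cover (packingP r0) hp.
by case: packing ys.
Qed.

(** Packing numbers grow at most like [r ^- n], so passing from [t * r] to [r]
    cannot multiply them by more than [q > t ^+ n] at every small scale: along the
    radii [r1 / t ^+ k] this would make them grow like [q ^+ k]. *)
Lemma packing_growth t q r0 p : esphere p -> 1 < t -> t ^+ n < q -> 0 < r0 ->
  exists2 r, 0 < r < r0 &
    (size (packing r))%:R <= q * (size (packing (t * r)))%:R.
Proof.
move=> hp t1 tq r00; apply: contrapT => h.
have t0 : 0 < t by lra.
have tn0 : 0 < t ^+ n by rewrite exprn_gt0.
have q0 : 0 < q by apply: lt_trans tq.
pose r1 := Num.min r0 2^-1.
have hr1 : 0 < r1 <= 2^-1 by rewrite lt_min r00 invr_gt0 ltr0n ge_min lexx orbT.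
have r1r0 : r1 <= r0 by rewrite ge_min lexx.
pose rk k := r1 / t ^+ k.
have rk0 k : 0 < rk k by rewrite divr_gt0 ?exprn_gt0//; case/andP: hr1.
have rk1 k : rk k <= r1.
  rewrite ler_pdivrMr ?exprn_gt0// ler_peMr//; first by rewrite ltW//; case/andP: hr1.
  by rewrite exprn_ege1// ltW.
have rkS k : t * rk k.+1 = rk k.
  by rewrite /rk exprS; field; rewrite !gt_eqF ?exprn_gt0.
have rkS0 k : rk k.+1 < r0.
  apply: lt_le_trans (le_trans (rk1 k) r1r0); rewrite -(rkS k) ltr_pMl//.
have lower k : q ^+ k <= (size (packing (rk k)))%:R.
  elim: k => [|k IH]; first by rewrite expr0 ler1n (packing_gt0 _ hp).
  have : q * (size (packing (t * rk k.+1)))%:R < (size (packing (rk k.+1)))%:R.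
    rewrite ltNge; apply/negP => hk; apply: h; exists (rk k.+1) => //.
    by rewrite rk0 rkS0.
  move=> /ltW; apply: le_trans; rewrite rkS exprS.
  by rewrite ler_wpM2l// ltW.
pose C := ((4 * n%:R + 3) / r1) ^+ n.
have upper k : (size (packing (rk k)))%:R <= C * (t ^+ n) ^+ k.
  have hk : 0 < rk k <= 2^-1 by rewrite rk0 (le_trans (rk1 k))//; case/andP: hr1.
  have := separated_size_le hk (proj1 (packingP (rk0 k))).
  by rewrite /C /rk exprAC -exprMn invfM invrK mulrA.
pose e := q / t ^+ n - 1.
have e0 : 0 < e by rewrite subr_gt0 ltr_pdivlMr// mul1r.
have bounded k : 1 + k%:R * e <= C.
  apply: (@le_trans _ _ ((1 + e) ^+ k)); first by apply: bernoulli_ineq; lra.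
  rewrite /e addrC subrK expr_div_n ler_pdivrMr ?exprn_gt0//.
  exact: le_trans (lower k) (upper k).
have := bounded (Num.truncn (C / e)).+1.
have := @truncnS_gt R (C / e); rewrite ltr_pdivrMr// => h1 h2; lra.
Qed.

End MaximalSeparated.

(** * Borel measurability of caps *)
Section BorelSets.
Context {R : realType} {n : nat}.
Implicit Types (u v x y p : 'rV[R]_n) (phi : R).

Lemma measurable_closed (A : set (borelRn R n)) :
  closed (A : set 'rV[R]_n) -> measurable A.
Proof.
move=> cA; rewrite -(setCK A); apply: measurableC.
by apply: sub_sigma_algebra; rewrite /= openC.
Qed.

Lemma continuous_dotp (f g : 'rV[R]_n -> 'rV[R]_n) :
  continuous f -> continuous g -> continuous (fun x => dotp (f x) (g x)).
Proof.
move=> cf cg; apply: continuous_big => [x|i _ x]; first exact: add_continuous.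
apply: cvgM; first exact: (nbhs_filter x).
- exact: (cvg_comp f _ (cf x) (@coord_continuous R 1 n 0 i (f x))).
- exact: (cvg_comp g _ (cg x) (@coord_continuous R 1 n 0 i (g x))).
Qed.

Lemma closed_esphere : closed (@esphere R n).
Proof.
have -> : @esphere R n = (fun x => dotp x x) @^-1` [set 1].
  by apply/seteqP; split => x /esphereP.
apply: closed_comp => [x _|]; last exact: closed_eq.
by apply: (@continuous_dotp id id) => ?; exact: cvg_id.
Qed.

Lemma cap_dotp u phi : esphere u -> 0 <= phi <= pi ->
  cap u phi = @esphere R n `&` [set v | cos phi <= dotp u v].
Proof.
move=> hu hphi; apply/seteqP; split => v [hv] h; split=> //.
- by rewrite /= -angle_le.
- by rewrite angle_le.
Qed.

Lemma closed_cap u phi : esphere u -> 0 <= phi <= pi -> closed (cap u phi).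
Proof.
move=> hu hphi; rewrite cap_dotp//; apply: closedI; first exact: closed_esphere.
rewrite [X in closed X](_ : _ = (dotp u) @^-1` [set x | cos phi <= x])//.
apply: closed_comp => [x _|]; last exact: closed_ge.
apply: (@continuous_dotp (cst u) id); first exact: cst_continuous.
by move=> ?; exact: cvg_id.
Qed.

End BorelSets.

(** * Counting points in caps by integration *)
Section HaarMeasure.
Context {R : realType} {n : nat} (sigma : probability (borelRn R n) R).
Implicit Types (u v x y p : 'rV[R]_n) (phi c : R) (U A B : set (borelRn R n))
  (s : seq 'rV[R]_n).

(** Real-valued form of the measure; on caps it is [Omega]. *)
Definition mass U : R := fine (sigma U).

Lemma massK U : measurable U -> (mass U)%:E = sigma U.
Proof. by move=> mU; rewrite fineK// fin_num_measure. Qed.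

Lemma mass_ge0 U : 0 <= mass U.
Proof. exact: fine_ge0. Qed.

Lemma mass_le A B : measurable A -> measurable B -> A `<=` B -> mass A <= mass B.
Proof. by move=> mA mB AB; rewrite -lee_fin !massK// le_measure// inE. Qed.

Lemma massD A B : measurable A -> measurable B ->
  mass (A `\` B) = mass A - mass (A `&` B).
Proof.
move=> mA mB; apply: EFin_inj; rewrite EFinB !massK//.
- by rewrite measureD// ltey_eq fin_num_measure.
- exact: measurableI.
- exact: measurableD.
Qed.

(** By symmetry of the angle this is also the number of the caps of radius [phi]
    centred at the points of [s] that contain [x]. *)
Definition cap_count phi s x := count (fun y => angle x y <= phi) s.

Section Counting.
Context (U : set (borelRn R n)) (s : seq 'rV[R]_n) (phi : R).
Context (mU : measurable U) (US : U `<=` @esphere R n).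
Context (hs : {in s, forall y, esphere y}) (hphi : 0 <= phi <= pi).

Let capT (i : 'I_(size s)) : set (borelRn R n) := cap (tnth (in_tuple s) i) phi.

Let measurable_capT i : measurable (capT i).
Proof.
apply: measurable_closed; apply: closed_cap hphi.
by apply: hs; exact: (mem_tnth i (in_tuple s)).
Qed.

Let cap_count_sum x : esphere x ->
  (\sum_(i < size s) (\1_(capT i) x : R)%:E = (cap_count phi s x)%:R%:E)%E.
Proof.
move=> hx; rewrite sumEFin /cap_count -sum1_count natr_sum; congr (_%:E).
rewrite [RHS]big_mkcond [RHS]big_tnth /=; apply: eq_bigr => i _; rewrite indicE /capT.
case: ifPn => h; first by rewrite mem_set//; split => //; rewrite angleC.
by rewrite memNset// => -[_]; rewrite angleC; apply/negP.
Qed.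

Let measurable_capT_indic i :
  measurable_fun U (fun x => (\1_(capT i) x : R)%:E).
Proof. by apply/measurable_EFinP; exact: measurable_indic. Qed.

(** Double counting: both sides measure the pairs of a point of [U] and a cap
    containing it. This finite sum stands in for an integral over all centres. *)
Let sum_mass_cap_integral :
  ((\sum_(y <- s) mass (U `&` cap y phi))%:E =
   \int[sigma]_(x in U) (\sum_(i < size s) (\1_(capT i) x : R)%:E))%E.
Proof.
rewrite ge0_integral_sum//.
rewrite big_tnth -sumEFin; apply: eq_bigr => i _.
have mc := measurable_capT i.
rewrite (integral_indic _ mU mc) setIC massK; first by [].
exact: measurableI mc mU.
Qed.

Lemma cap_count_ge c : 0 <= c -> (forall x, U x -> c <= (cap_count phi s x)%:R) ->
  c * mass U <= \sum_(y <- s) mass (U `&` cap y phi).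
Proof.
move=> c0 h; rewrite -lee_fin EFinM massK// sum_mass_cap_integral.
rewrite -integral_cst//; apply: ge0_le_integral => //.
- exact: emeasurable_sum.
- by move=> x Ux; rewrite cap_count_sum ?lee_fin ?h//; exact: US.
Qed.

Lemma cap_count_le c : (forall x, U x -> (cap_count phi s x)%:R <= c) ->
  \sum_(y <- s) mass (U `&` cap y phi) <= c * mass U.
Proof.
move=> h; rewrite -lee_fin EFinM massK// sum_mass_cap_integral.
rewrite -integral_cst//; apply: ge0_le_integral => //.
- by move=> x Ux; rewrite cap_count_sum ?lee_fin//; exact: US.
- exact: emeasurable_sum.
- by move=> x Ux; rewrite cap_count_sum ?lee_fin ?h//; exact: US.
Qed.

End Counting.
End HaarMeasure.

(** * Cap masses compared through packings *)
Lemma exists_ge_average (R : realType) (T : eqType) (s : seq T) (F : T -> R) c :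
  (0 < size s)%N -> (size s)%:R * c <= \sum_(y <- s) F y ->
  exists2 y, y \in s & c <= F y.
Proof.
move=> s0 h; apply: contrapT => hN; move: h; apply/negP; rewrite -ltNge.
have lt_c y : y \in s -> F y < c.
  by move=> ys; rewrite ltNge; apply/negP => cF; apply: hN; exists y.
rewrite mulr_natl -[_ *+ _]iter_addr_0 -count_predT -big_const_seq.
rewrite big_seq [ltRHS]big_seq; apply: ltr_sum => //.
by case: s s0 {hN lt_c} => // y s _; rewrite /= mem_head.
Qed.

Section CapMass.
Context {R : realType} {n : nat} (sigma : probability (borelRn R n) R).
Context (n2 : (2 <= n)%N) (hsigma : sphere_haar sigma).
Implicit Types (u v x y p q : 'rV[R]_n) (phi c r t : R) (U A B : set (borelRn R n))
  (s : seq 'rV[R]_n).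

Local Notation mass := (mass sigma).

Lemma measurable_cap u phi : esphere u -> 0 <= phi <= pi ->
  measurable (cap u phi : set (borelRn R n)).
Proof. by move=> hu hphi; apply: measurable_closed; exact: closed_cap. Qed.

Lemma measurable_esphere : measurable (@esphere R n : set (borelRn R n)).
Proof. by apply: measurable_closed; exact: closed_esphere. Qed.

Lemma mass_esphere : mass (@esphere R n) = 1.
Proof. by rewrite /mass (proj1 hsigma). Qed.

Lemma mass_cap_const u v phi : esphere u -> esphere v -> 0 <= phi <= pi ->
  mass (cap u phi) = mass (cap v phi).
Proof.
move=> hu hv hphi; have [Q hQ uQ] := rotation_transitive n2 hu hv.
rewrite /mass -(proj2 hsigma _ _ hQ (measurable_cap hv hphi)).
congr (fine (sigma _)); apply/seteqP; split => x /=.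
  move=> [hx ux]; split; first exact: rotation_esphere.
  by rewrite -uQ /angle dotp_rotation.
move=> [/esphereP hx ux]; rewrite dotp_rotation// in hx.
split; first exact/esphereP.
by move: ux; rewrite -uQ /angle dotp_rotation.
Qed.

Lemma esphere_cap_setI u phi : (@esphere R n `&` cap u phi = cap u phi)%classic.
Proof. by apply/setIidPr => x []. Qed.

Lemma mass_cap_le1 u phi : esphere u -> 0 <= phi <= pi -> mass (cap u phi) <= 1.
Proof.
move=> hu hphi; rewrite -mass_esphere.
apply: mass_le; first exact: measurable_cap.
- exact: measurable_esphere.
- by move=> ? [].
Qed.
Lemma sum_mass_cap s u phi : {in s, forall y, esphere y} -> esphere u ->
  0 <= phi <= pi ->
  \sum_(y <- s) mass (cap y phi) = (size s)%:R * mass (cap u phi).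
Proof.
move=> hs hu hphi; rewrite big_seq; under eq_bigr => y ys.
  rewrite (mass_cap_const (hs _ ys) hu hphi); over.
by rewrite -big_seq big_const_seq count_predT iter_addr_0 mulr_natl.
Qed.

(** The mean of [cap_count phi s] over the sphere is
    [(size s)%:R * mass (cap u phi)], and some point reaches the mean. *)
Lemma rich_cap s u phi : {in s, forall y, esphere y} -> esphere u ->
  0 <= phi <= pi ->
  exists2 p, esphere p & (size s)%:R * mass (cap u phi) <= (cap_count phi s p)%:R.
Proof.
move=> hs hu hphi.
pose P k := `[< exists2 p, esphere p & cap_count phi s p = k >].
have exP : exists k, P k.
  by exists (cap_count phi s u); apply/asboolP; exists u.
have ubP k : P k -> (k <= size s)%N.
  by move=> /asboolP[p _ <-]; exact: count_size.
case: (ex_maxnP exP ubP) => k /asboolP[p hp <-] h; exists p => //.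
rewrite -sum_mass_cap//; under eq_bigr do rewrite -esphere_cap_setI.
have := @cap_count_le R n sigma _ s phi measurable_esphere (@subset_refl _ _)
  hs hphi (cap_count phi s p)%:R.
rewrite mass_esphere mulr1; apply.
by move=> x hx; rewrite ler_nat; apply: h; apply/asboolP; exists x.
Qed.

(** Exchange argument. Shrink the points of [s'] towards [p] by the factor [t]:
    they become [r]-separated and lie within [phi] of [p], hence at angle at least
    [r] from the points of the packing beyond [phi + r]. Replacing the points of
    the packing within [phi + r] by them gives an [r]-separated family, which
    cannot outnumber a maximal one. *)
Lemma packing_exchange p t r phi s' : esphere p -> 1 < t -> 0 < r -> 0 <= phi ->
  t * phi < pi / 2 -> separated (t * r) (cap p (t * phi)) s' ->
  (size s' <= cap_count (phi + r) (packing r) p)%N.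
Proof.
move=> hp t1 r0 phi0 tphi [sc ss].
have t0 : 0 < t by lra.
have ht : 0 <= t^-1 <= 1 by rewrite invr_ge0 ltW//= invf_le1// ltW.
have [[pS ps] pmax] := @packingP R n _ r0.
pose far := [seq y <- packing r | phi + r < angle p y].
pose s := [seq shrink t^-1 p x | x <- s'] ++ far.
have lt2 x : x \in s' -> angle p x < pi / 2.
  by move=> /sc[_] /le_lt_trans; apply.
suff /pmax : separated r esphere s.
  rewrite size_cat size_map size_filter.
  rewrite -(count_predC (fun y => angle p y <= phi + r) (packing r)).
  rewrite (@eq_count _ (predC _) (fun y => phi + r < angle p y)).
    by rewrite leq_add2r.
  by move=> y /=; rewrite ltNge.
split => [y|].
  rewrite mem_cat => /orP[/mapP[x xs ->]|]; last by rewrite mem_filter => /andP[_ /pS].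
  by apply: shrink_esphere => //; [exact: (sc _ xs).1|exact: lt2].
rewrite pairwise_cat; apply/and3P; split; last exact: pairwise_filter.
- apply/allrelP => _ y /mapP[x xs ->]; rewrite mem_filter => /andP[py /pS hy].
  have hx := (sc _ xs).1.
  have hsx : esphere (shrink t^-1 p x) by apply: shrink_esphere => //; exact: lt2.
  have := angle_triangle hsx hp hy; rewrite (angleC _ p).
  rewrite angle_shrink//; last exact: lt2.
  have : t^-1 * angle p x <= phi by rewrite ler_pdivrMl//; exact: (sc _ xs).2.
  move: py; lra.
- rewrite pairwise_map; apply: (sub_in_pairwise _ (allss s') ss) => x y xs ys /=.
  have := angle_shrink_ge ht hp (sc _ xs).1 (sc _ ys).1 (lt2 _ xs) (lt2 _ ys).
  by move=> h1 h2; apply: le_trans h1; rewrite ler_pdivlMl.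
Qed.

(** A maximal packing is evenly spread: every cap of radius [phi + r] holds as
    many of its points as an average cap of radius [t * phi] holds of a packing
    at scale [t * r]. The rich cap of the coarse packing is rotated to [p] before
    the exchange. *)
Lemma packing_cap_count u p t r phi : esphere u -> esphere p -> 1 < t -> 0 < r ->
  0 <= phi -> t * phi < pi / 2 ->
  (size (packing (t * r) : seq 'rV[R]_n))%:R * mass (cap u (t * phi)) <=
  (cap_count (phi + r) (packing r) p)%:R.
Proof.
move=> hu hp t1 r0 phi0 tphi; have tr0 : 0 < t * r by rewrite mulr_gt0//; lra.
have [[pS ps] _] := @packingP R n _ tr0.
have htphi : 0 <= t * phi <= pi.
  by rewrite mulr_ge0//=; [have := @pi_gt0 R; lra|lra].
have [q hq] := rich_cap pS hu htphi.
move=> /le_trans; apply; rewrite ler_nat /cap_count.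
have [Q hQ qQ] := rotation_transitive n2 hq hp.
have := @packing_exchange p t r phi
  [seq y *m Q | y <- packing (t * r) & angle q y <= t * phi] hp t1 r0 phi0 tphi.
rewrite size_map size_filter; apply; split.
  move=> z /mapP[y]; rewrite mem_filter => /andP[qy /pS hy] ->.
  by split; [exact: rotation_esphere|rewrite -qQ /angle dotp_rotation].
rewrite pairwise_map; apply: pairwise_filter; apply: sub_pairwise ps => x y /=.
by rewrite /angle dotp_rotation.
Qed.

(** One step of the greedy covering, together with the comparison
    [mass (cap u beta) >= kappa ^+ n * mass (cap u alpha)]. The centre is sought
    among the points of a packing at a scale [r] given by [packing_growth], with
    [t] chosen in the open interval from [alpha / beta] to [kappa^-1]. Each point
    of [U] is then within [beta] of at least a fraction
    [kappa ^+ n * mass (cap u alpha)] of the packing, so on average a cap of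
    radius [beta] centred in the packing takes that fraction of [U]. *)
Lemma greedy_cap u alpha beta kappa U : esphere u -> 0 < beta < alpha ->
  alpha < pi / 2 -> 0 < kappa -> kappa < beta / alpha ->
  measurable U -> U `<=` @esphere R n ->
  exists2 y, esphere y &
    kappa ^+ n * mass (cap u alpha) * mass U <= mass (U `&` cap y beta).
Proof.
move=> hu /andP[b0 ba] api k0 kba mU US.
have a0 : 0 < alpha by lra.
(* t^-1 is the midpoint of kappa and beta / alpha *)
pose t := 2 / (kappa + beta / alpha).
have ba1 : beta / alpha < 1 by rewrite ltr_pdivrMr ?mul1r.
have ba0 : 0 < beta / alpha by rewrite divr_gt0.
have t1 : 1 < t by rewrite ltr_pdivlMr; lra.
have tk : t < kappa^-1.
  by rewrite ltr_pdivrMr; [rewrite ltr_pdivlMl; lra|lra].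
have phib : alpha / t < beta.
  rewrite /t invf_div mulrA ltr_pdivrMr//.
  have -> : alpha * (kappa + beta / alpha) = alpha * kappa + beta.
    by field; rewrite gt_eqF.
  have : kappa * alpha < beta by rewrite -ltr_pdivlMr.
  lra.
have t0 : 0 < t by lra.
have phi0 : 0 < alpha / t by rewrite divr_gt0.
have r00 : 0 < beta - alpha / t by rewrite subr_gt0.
have tn : t ^+ n < (kappa^-1) ^+ n.
  by rewrite ltrXn2r ?nnegrE ?invr_ge0 ?ltW//; case: n n2.
have [r /andP[r0 rr] hr] := packing_growth hu t1 tn r00.
have [[pS ps] _] := @packingP R n _ r0.
have hbeta : 0 <= beta <= pi by have := @pi_gt0 R; lra.
pose M : R := (size (packing r : seq 'rV[R]_n))%:R.
have M0 : 0 < M by rewrite ltr0n (packing_gt0 r0 hu).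
set w := kappa ^+ n * mass (cap u alpha).
have w0 : 0 <= w by rewrite mulr_ge0 ?mass_ge0// exprn_ge0// ltW.
have count_lb x : U x -> M * w <= (cap_count beta (packing r) x)%:R.
  move=> /US hx.
  have ta : t * (alpha / t) = alpha by field; rewrite gt_eqF.
  have := @packing_cap_count u x t r (alpha / t) hu hx t1 r0 (ltW phi0).
  rewrite ta => /(_ api) h.
  apply: (@le_trans _ _ (cap_count (alpha / t + r) (packing r) x)%:R).
    apply: le_trans h; rewrite /w mulrA ler_wpM2r ?mass_ge0//.
    by rewrite -ler_pdivlMr ?exprn_gt0// mulrC -exprVn.
  rewrite ler_nat; apply: sub_count => y /= /le_trans; apply; lra.
have sum_lb := cap_count_ge sigma mU US pS hbeta (mulr_ge0 (ltW M0) w0) count_lb.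
rewrite -mulrA in sum_lb.
have [y /pS hy] := exists_ge_average (packing_gt0 r0 hu) sum_lb.
by exists y.
Qed.

End CapMass.

(** * Economical coverings of the sphere by caps *)
Section SphereCovering.
Context {R : realType} {n : nat} (sigma : probability (borelRn R n) R).
Context (n2 : (2 <= n)%N) (hsigma : sphere_haar sigma).
Implicit Types (u v x y p q : 'rV[R]_n) (phi c r t : R) (U A B : set (borelRn R n))
  (s : seq 'rV[R]_n).

Local Notation mass := (mass sigma).

(** Finitely many caps of radius [phi] cover the sphere. *)
Lemma mass_cap_gt0 u phi : esphere u -> 0 < phi <= pi -> 0 < mass (cap u phi).
Proof.
move=> hu /andP[phi0 phipi].
have hphi : 0 <= phi <= pi by rewrite ltW.
have pk := packingP (R := R) (n := n) phi0.
have [[pS ps] _] := pk.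
have := @cap_count_ge R n sigma _ (packing phi) phi measurable_esphere
  (@subset_refl _ _) pS hphi 1 ler01.
rewrite mass_esphere// mulr1; under eq_bigr do rewrite esphere_cap_setI.
rewrite (sum_mass_cap n2 hsigma pS hu hphi) => h.
have {h} h : 1 <= (size (packing phi : seq 'rV[R]_n))%:R * mass (cap u phi).
  apply: h => x hx; rewrite ler1n -has_count; apply/hasP.
  by have [y ys /ltW xy] := max_separated_cover pk hx; exists y.
rewrite lt_def mass_ge0 andbT; apply/eqP => m0; move: h.
by rewrite m0 mulr0 ler10.
Qed.

(** Scaling the radius by a factor greater than [kappa] scales the mass by at
    least [kappa ^+ n]: the case of [greedy_cap] where [U] is the sphere. *)
Lemma mass_cap_ratio u alpha eps kappa : esphere u -> 0 < eps < alpha ->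
  alpha < pi / 2 -> 0 < kappa -> kappa < eps / alpha ->
  kappa ^+ n * mass (cap u alpha) <= mass (cap u eps).
Proof.
move=> hu heps api k0 kea.
have [y hy] := greedy_cap n2 hsigma hu heps api k0 kea measurable_esphere
  (@subset_refl _ _).
rewrite esphere_cap_setI mass_esphere// mulr1 (mass_cap_const n2 hsigma hy hu)//.
by have := @pi_gt0 R; lra.
Qed.

Definition uncovered phi s : set (borelRn R n) :=
  foldr (fun x A => A `\` cap x phi) (@esphere R n) s.

Lemma uncoveredP phi s v :
  uncovered phi s v <-> esphere v /\ {in s, forall x, phi < angle x v}.
Proof.
elim: s => [|x s IH] /=; first by split=> [|[]].
split=> [[/IH[hv hs] nx]|[hv hs]].
  split=> // y; rewrite inE => /predU1P[->|/hs//].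
  by rewrite ltNge; apply/negP => xv; apply: nx.
split; first by apply/IH; split=> // y ys; apply: hs; rewrite inE ys orbT.
by case=> _; apply/negP; rewrite -ltNge hs ?mem_head.
Qed.

Lemma measurable_uncovered phi s : 0 <= phi <= pi ->
  {in s, forall x, esphere x} -> measurable (uncovered phi s).
Proof.
move=> hphi; elim: s => [|x s IH] hs /=; first exact: measurable_esphere.
apply: measurableD; first by apply: IH => y ys; apply: hs; rewrite inE ys orbT.
by apply: measurable_cap => //; apply: hs; rewrite mem_head.
Qed.

Lemma greedy_cover u alpha beta kappa k : esphere u -> 0 < beta < alpha ->
  alpha < pi / 2 -> 0 < kappa -> kappa < beta / alpha ->
  exists s, [/\ size s = k, {in s, forall x, esphere x} &
    mass (uncovered beta s) <= (1 - kappa ^+ n * mass (cap u alpha)) ^+ k].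
Proof.
move=> hu hb api k0 kba; set w := _ * _.
have hbeta : 0 <= beta <= pi by have := @pi_gt0 R; lra.
have w1 : w <= 1.
  apply: le_trans (mass_cap_ratio hu hb api k0 kba) _.
  exact: mass_cap_le1.
elim: k => [|k [s [sk sS hs]]].
  by exists [::]; split => //=; rewrite expr0 mass_esphere.
have mU := measurable_uncovered hbeta sS.
have US : uncovered beta s `<=` @esphere R n by move=> v /uncoveredP[].
have [y hy hyU] := greedy_cap n2 hsigma hu hb api k0 kba mU US.
exists (y :: s); split => [|x|]; first by rewrite /= sk.
  by rewrite inE => /predU1P[->|/sS].
rewrite /= massD//; last exact: measurable_cap.
rewrite -/w in hyU; rewrite exprS.
apply: (@le_trans _ _ ((1 - w) * mass (uncovered beta s))); first lra.
by rewrite ler_wpM2l// subr_ge0.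
Qed.

Lemma separated_cap_count_le1 eps alpha s x : esphere x ->
  {in s, forall y, esphere y} ->
  pairwise (fun y z => alpha <= angle y z) s -> 2 * eps < alpha ->
  (cap_count eps s x <= 1)%N.
Proof.
move=> hx hs ss ea; rewrite /cap_count -size_filter.
set f := [seq y <- s | angle x y <= eps].
have sf : pairwise (fun y z => alpha <= angle y z) f by exact: pairwise_filter.
have hf y : y \in f -> esphere y /\ angle x y <= eps.
  by rewrite mem_filter => /andP[xy /hs].
case: f sf hf => [|y [|z f]]//= /andP[/andP[yz _] _] hf.
have [hy xy] := hf y (mem_head _ _).
have [hz xz] : esphere z /\ angle x z <= eps by apply: hf; rewrite !inE eqxx orbT.
have := angle_triangle hx hy hz; lra.
Qed.

(** The argument of Rogers. Greedy caps of radius about [a * alpha] are placed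
    until the uncovered set has mass at most [b ^+ n]. Then a maximal
    [alpha]-separated family is taken among the points at angle at least [alpha]
    from all the centres. Its caps of radius about [b * alpha] are disjoint
    because [2 * b < 1] and uncovered because [a + b < 1]; each has mass at least
    [b ^+ n * mass (cap u alpha)], so there are at most [(mass (cap u alpha))^-1]
    of them. Caps of radius [alpha] around both families cover the sphere, even
    with strict inequalities. *)
Lemma sphere_covering u alpha a b : esphere u -> 0 < alpha < pi / 2 ->
  0 < a -> 0 < b -> a + b < 1 -> 2 * b < 1 ->
  exists s, [/\ {in s, forall x, esphere x},
    (forall v, esphere v -> exists2 x, x \in s & angle x v < alpha) &
    (size s)%:R <= (a ^- n * (n%:R * - ln b) + 2) / mass (cap u alpha)].
Proof.
move=> hu /andP[al0 api] a0 b0 ab b2.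
have pi0 := @pi_gt0 R.
have a1 : a <= 1 by lra.
(* slack that makes the ratios beta / alpha > a and eps / alpha > b strict *)
pose e := Num.min ((1 - a - b) / 3) ((1 - 2 * b) / 3).
have e0 : 0 < e by rewrite lt_min; apply/andP; split; lra.
have e1 : e <= (1 - a - b) / 3 by rewrite ge_min lexx.
have e2 : e <= (1 - 2 * b) / 3 by rewrite ge_min lexx orbT.
pose beta := (a + e) * alpha; pose eps := (b + e) * alpha.
have hbeta : 0 < beta < alpha by rewrite /beta; apply/andP; split; nra.
have heps : 0 < eps < alpha by rewrite /eps; apply/andP; split; nra.
have be : beta + eps < alpha by rewrite /beta /eps; nra.
have ee : 2 * eps < alpha by rewrite /eps; nra.
have kba : a < beta / alpha by rewrite mulfK ?gt_eqF//; lra.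
have kea : b < eps / alpha by rewrite mulfK ?gt_eqF//; lra.
set m := mass (cap u alpha).
have m0 : 0 < m by apply: mass_cap_gt0 => //; lra.
have m1 : m <= 1 by apply: mass_cap_le1 => //; lra.
pose w := a ^+ n * m.
have w0 : 0 < w by rewrite mulr_gt0// exprn_gt0.
pose L := n%:R * - ln b.
have L0 : 0 <= L by rewrite mulr_ge0// oppr_ge0 ln_le0//; lra.
have [N ltN Nle] : exists2 N : nat, L / w < N%:R & N%:R <= L / w + 1.
  exists (Num.truncn (L / w)).+1; first exact: truncnS_gt.
  by rewrite -natr1 lerD2r truncn_le divr_ge0// ltW.
have [xs [xsN xsS hxs]] := greedy_cover N hu hbeta api a0 kba.
have bn0 : 0 < b ^+ n by rewrite exprn_gt0.
have small : mass (uncovered beta xs) <= b ^+ n.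
  apply: (le_trans hxs); rewrite -/m -/w.
  have h1 : 1 - w <= expR (- w) by exact: expR_ge1Dx.
  have hw : 0 <= 1 - w.
    rewrite subr_ge0; apply: mulr_ile1 => //; [exact/exprn_ge0/ltW|exact: ltW|].
    exact: exprn_ile1 (ltW a0) a1.
  apply: (@le_trans _ _ (expR (- w) ^+ N)); first by rewrite lerXn2r ?nnegrE ?expR_ge0.
  rewrite -expRM_natl -[b in leRHS]lnK ?posrE// -expRM_natl ler_expR.
  have : L < w * N%:R by rewrite mulrC -ltr_pdivrMr.
  by rewrite /L mulrN [_ * - w]mulrN (mulrC N%:R); lra.
pose V : set 'rV[R]_n := [set v | esphere v /\ {in xs, forall x, alpha <= angle x v}].
have [ys ysmax] := @exists_max_separated R n alpha V al0 (fun v => @proj1 _ _).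
have [[ysV yss] _] := ysmax.
have ysS : {in ys, forall y, esphere y} by move=> y /ysV[].
have heps' : 0 <= eps <= pi by lra.
have hbeta' : 0 <= beta <= pi by lra.
have mU := measurable_uncovered hbeta' xsS.
have US : uncovered beta xs `<=` @esphere R n by move=> v /uncoveredP[].
have ysm : (size ys)%:R * m <= 1.
  have h := @cap_count_le R n sigma _ ys eps mU US ysS heps' 1 _.
  have : \sum_(y <- ys) mass (uncovered beta xs `&` cap y eps) <=
      1 * mass (uncovered beta xs).
    apply: h => x /US hx; rewrite lern1.
    exact: separated_cap_count_le1 ysS yss ee.
  have -> : \sum_(y <- ys) mass (uncovered beta xs `&` cap y eps) =
      \sum_(y <- ys) mass (cap y eps).
    rewrite big_seq [RHS]big_seq; apply: eq_bigr => y ysy; congr mass.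
    apply/setIidPr => z [hz yz]; apply/uncoveredP; split => // x xxs.
    have [hy /(_ _ xxs) xy] := ysV _ ysy.
    have := angle_triangle hz (xsS _ xxs) hy.
    rewrite (angleC z x) (angleC z y); lra.
  rewrite (sum_mass_cap n2 hsigma ysS hu heps') mul1r => /le_trans /(_ small) h2.
  have h3 := mass_cap_ratio hu heps api b0 kea.
  have h4 : (size ys)%:R * (b ^+ n * m) <= b ^+ n.
    by apply: le_trans h2; rewrite ler_wpM2l.
  by rewrite -(ler_pM2l bn0) mulr1; apply: le_trans h4; rewrite mulrCA.
exists (xs ++ ys); split.
- by move=> x; rewrite mem_cat => /orP[/xsS|/ysS].
- move=> v hv; apply: contrapT => hN.
  have vV : V v.
    split => // x xxs; rewrite leNgt; apply/negP => xv.
    by apply: hN; exists x => //; rewrite mem_cat xxs.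
  have [y yys vy] := max_separated_cover ysmax vV.
  by apply: hN; exists y; rewrite 1?angleC// mem_cat yys orbT.
- rewrite size_cat natrD xsN -/L ler_pdivlMr//.
  have : N%:R * m <= (L / w + 1) * m by rewrite ler_wpM2r// ltW.
  have -> : (L / w + 1) * m = a ^- n * L + m.
    by rewrite /w; field; rewrite !gt_eqF// exprn_gt0.
  rewrite mulrDl; lra.
Qed.

End SphereCovering.

(** * Choice of the two radii *)
Section CoveringParameters.
Context {R : realType}.

Lemma ln_le_sub1 (x : R) : 0 < x -> ln x <= x - 1.
Proof. by move=> x0; have := expR_ge1Dx (ln x); rewrite lnK ?posrE//; lra. Qed.

Lemma inv_pow_le (n : nat) (d s : R) : (0 < n)%N -> 0 < d -> s < 1 ->
  d = s / n%:R -> (1 - d) ^- n <= (1 - s)^-1.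
Proof.
move=> n0 d0 s1 dE; have nn : 0 < n%:R :> R by rewrite ltr0n.
have n1 : 1 <= n%:R :> R by rewrite ler1n.
have nd : n%:R * d = s by rewrite dE mulrCA divff ?mulr1// gt_eqF.
have d1 : d <= 1 by nra.
have h := @bernoulli_ineq R (- d) n; rewrite mulrN nd in h.
have {}h : 1 - s <= (1 - d) ^+ n by apply: h; lra.
by rewrite lef_pV2 ?posrE; lra.
Qed.

(** With [x = ln n], the values [b = (e n x)^-1] and [a = 1 - (n x)^-1] give
    [- ln b = 1 + x + ln x] and [a ^- n <= x / (x - 1)], so the main term
    [n * (x + ln x)] gets only a correction of order [n]. They need [x] away from
    1; for [x <= 5 / 2] the values [b = (e n)^-1] and [a = 1 - (2 n)^-1] give
    [a ^- n <= 2] and [- ln b = 1 + x], and the term [5 n] absorbs the loss. *)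
Lemma covering_parameters (n : nat) : (2 <= n)%N -> exists a b : R,
  [/\ 0 < a, 0 < b, a + b < 1, 2 * b < 1 &
  a ^- n * (n%:R * - ln b) + 2 <=
    n%:R * ln n%:R + n%:R * ln (ln n%:R) + 5 * n%:R].
Proof.
move=> n2; set N : R := n%:R.
have N2 : 2 <= N by rewrite ler_nat.
have N0 : 0 < N by lra.
set x := ln N.
have x_lt : x <= N - 1 by exact: ln_le_sub1.
have x_ge : 2^-1 <= x.
  have := @ln_le_sub1 N^-1; rewrite invr_gt0 lnV ?posrE// => /(_ N0).
  have : N^-1 <= 2^-1 by rewrite lef_pV2 ?posrE.
  rewrite -/x; lra.
have x0 : 0 < x by lra.
have e2 : 2 < expR 1 :> R by have := @expR_gt1Dx R 1 (oner_neq0 _); lra.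
have e0 : 0 < expR 1 :> R by exact: expR_gt0.
have [xs|xl] := leP x (5 / 2).
  pose d := 2^-1 / N; pose b := (expR 1 * N)^-1.
  have d0 : 0 < d by rewrite divr_gt0.
  have bd : b < d.
    by rewrite /b /d -invfM ltf_pV2 ?posrE ?mulr_gt0// ltr_pM2r.
  have dN : d * N = 2^-1 by rewrite divfK// gt_eqF.
  have b0 : 0 < b by rewrite invr_gt0 mulr_gt0.
  have d4 : d <= 4^-1 by nra.
  exists (1 - d), b; split; [lra|by []|lra|lra|].
  have ap : (1 - d) ^- n <= 2.
    have := @inv_pow_le n d 2^-1 (ltnW n2) d0 _ erefl.
    have -> : (1 - 2^-1 : R)^-1 = 2 by field.
    by apply; lra.
  have lb : - ln b = 1 + x.
    by rewrite /b lnV ?posrE ?mulr_gt0// opprK lnM ?posrE// expRK.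
  rewrite lb.
  have lx : - ln x <= x^-1 - 1.
    by rewrite -lnV ?posrE//; apply: ln_le_sub1; rewrite invr_gt0.
  have hx : x + x^-1 <= 3.
    have xx : x * x^-1 = 1 by rewrite divff// gt_eqF.
    have xi : 0 < x^-1 by rewrite invr_gt0.
    nra.
  have h : (1 - d) ^- n * (N * (1 + x)) <= 2 * (N * (1 + x)).
    by apply: ler_wpM2r ap; apply: mulr_ge0; lra.
  have : N * (x - ln x) <= N * 2 by rewrite ler_pM2l//; lra.
  lra.
pose d := x^-1 / N; pose b := (expR 1 * (x * N))^-1.
have xi : 0 < x^-1 by rewrite invr_gt0.
have xx : x * x^-1 = 1 by rewrite divff// gt_eqF.
have d0 : 0 < d by rewrite divr_gt0.
have dN : d * N = x^-1 by rewrite divfK// gt_eqF.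
have b0 : 0 < b by rewrite invr_gt0 !mulr_gt0.
have bd : 2 * b < d.
  have -> : d = expR 1 * b by rewrite /b /d; field; rewrite !gt_eqF.
  by rewrite ltr_pM2r.
have xi1 : x^-1 <= 2 / 5 by nra.
have d4 : d <= 1 / 5 by nra.
exists (1 - d), b; split; [lra|by []|lra|lra|].
have ap : (1 - d) ^- n <= (1 - x^-1)^-1.
  by apply: (inv_pow_le (ltnW n2) d0) => //; lra.
have lb : - ln b = 1 + x + ln x.
  rewrite /b lnV ?posrE ?mulr_gt0// opprK lnM ?posrE ?mulr_gt0//.
  rewrite expRK lnM ?posrE// -/x; lra.
rewrite lb.
have lx : ln x <= x - 1 by exact: ln_le_sub1.
have lx0 : 0 <= ln x by apply: ln_ge0; lra.
have h : (1 - d) ^- n * (N * (1 + x + ln x)) <=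
    (1 - x^-1)^-1 * (N * (1 + x + ln x)).
  by apply: ler_wpM2r ap; apply: mulr_ge0; lra.
apply: (@le_trans _ _ ((1 - x^-1)^-1 * (N * (1 + x + ln x)) + 2)); first lra.
have E : (1 - x^-1)^-1 = 1 + (x - 1)^-1.
  by field; rewrite !gt_eqF//; lra.
rewrite E; set y := (x - 1)^-1.
have yE : y * (x - 1) = 1 by rewrite mulVf// gt_eqF//; lra.
have hy : y * (1 + x + ln x) <= 10 / 3.
  have y0 : 0 < y by rewrite invr_gt0; lra.
  have : y * (1 + x + ln x) <= y * (10 / 3 * (x - 1)) by rewrite ler_pM2l//; lra.
  by rewrite mulrCA yE mulr1.
have : N * (y * (1 + x + ln x)) <= N * (10 / 3) by rewrite ler_pM2l.
lra.
Qed.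

End CoveringParameters.

(** * From coverings to illumination *)
Lemma asin_gt0 (R : realType) (x : R) : 0 < x <= 1 -> 0 < asin x.
Proof.
move=> hx; have x1 : -1 <= x <= 1 by lra.
rewrite ltNge; apply/negP => as0.
have : 0 <= sin (- asin x).
  by apply: sin_ge0_pi; have := asin_geNpi2 x1; have := @pi_gt0 R; lra.
by rewrite sinN asinK ?in_itv//; lra.
Qed.

Section Illumination.
Context {R : realType} {n : nat}.
Implicit Types (K : set 'rV[R]_n) (b c v x : 'rV[R]_n) (rho : R).

Lemma interior_of_eball K rho x : 0 < rho -> eball rho `<=` K ->
  dotp x x < rho ^+ 2 -> interior K x.
Proof.
move=> rho0 hK hx.
have : nbhs x [set y : 'rV[R]_n | dotp y y < rho ^+ 2].
  apply: open_nbhs_nbhs; split => //.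
  rewrite [X in open X](_ : _ = (fun y => dotp y y) @^-1` [set z | z < rho ^+ 2])//.
  apply: open_comp => [y _|]; last exact: open_lt.
  by apply: (@continuous_dotp R n id id) => ?; exact: cvg_id.
apply: filterS => y /= hy; apply: hK; rewrite /eball /= /enorm.
by rewrite -(ger0_norm (ltW rho0)) -sqrtr_sqr ler_wsqrtr// ltW.
Qed.

(** With [c] the unit vector opposite to [b], the point of the ray from [b] in
    the direction [v] closest to the origin is at [lambda = N * dotp v c], where
    [N = enorm b]. Its squared distance to the origin is
    [N ^+ 2 * (1 - dotp v c ^+ 2)], less than [rho ^+ 2] as soon as the angle of
    [v] and [c] is less than [asin rho]. *)
Lemma illuminates_cap K rho b v : 0 < rho <= 1 -> eball rho `<=` K ->
  b != 0 -> enorm b <= 1 -> esphere v ->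
  angle v (- ((enorm b)^-1 *: b)) < asin rho -> illuminates K v b.
Proof.
move=> /andP[rho0 rho1] hK b0 b1 hv.
have bb := dotp_gt0 b0.
set N := enorm b in b1 *; have N0 : 0 < N by rewrite sqrtr_gt0.
have NN : dotp b b = N ^+ 2 by rewrite sqr_sqrtr// ltW.
set c := - _ => hvc.
have hc : esphere c.
  by apply/esphereP; rewrite !dotp_lin NN; field; rewrite gt_eqF.
have bE : b = - (N *: c) by rewrite scalerN opprK scalerA divff ?gt_eqF// scale1r.
have rho_itv : -1 <= rho <= 1 by lra.
have pi0 := @pi_gt0 R.
have has : 0 <= asin rho <= pi.
  apply/andP; split; last by have := asin_lepi2 rho_itv; lra.
  by rewrite ltW// asin_gt0// rho0.
set k := dotp v c.
have hk : Num.sqrt (1 - rho ^+ 2) < k.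
  by rewrite -cos_asin// ltNge /k -angle_ge// -ltNge.
have s0 := sqrtr_ge0 (1 - rho ^+ 2).
have hk2 : 1 - rho ^+ 2 < k ^+ 2.
  rewrite -[ltLHS]sqr_sqrtr; last by rewrite subr_ge0 expr_le1// ltW.
  by move: hk s0; rewrite !expr2; move: (Num.sqrt _) => z hk s0; nra.
exists (N * k); first by rewrite mulr_gt0// (le_lt_trans s0).
apply: (interior_of_eball rho0 hK).
have bv : dotp v b = - (N * k) by rewrite [in LHS]bE dotpNr dotpZr.
rewrite !dotp_lin (dotpC b v) bv NN; move/esphereP: hv => ->.
rewrite [ltLHS](_ : _ = N ^+ 2 * (1 - k ^+ 2)); last by ring.
apply: (@lt_le_trans _ _ (N ^+ 2 * rho ^+ 2)).
  by rewrite ltr_pM2l ?exprn_gt0//; lra.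
by rewrite ger_pMl ?exprn_gt0// expr_le1// ltW.
Qed.

Lemma boundary_unit_ball K b : compact K -> K `<=` eball 1 -> boundary K b ->
  enorm b <= 1.
Proof.
move=> cK hKB [clb _]; apply: hKB.
by apply: (compact_closed _ cK) clb; exact: norm_hausdorff.
Qed.

Lemma illumination_number_le K (s : seq 'rV[R]_n) :
  {in s, forall v, esphere v} ->
  (forall b, boundary K b -> exists2 v, v \in s & illuminates K v b) ->
  (illumination_number K <= (size s)%:R%:E)%E.
Proof.
move=> hs h; apply: ereal_inf_lbound; exists (size s) => //=.
exists (fun i => tnth (in_tuple s) i) => [i|b /h[v vs vb]].
  by apply: hs; exact: (mem_tnth i (in_tuple s)).
by have /tnthP[i vE] : v \in in_tuple s by []; exists i; rewrite -vE.
Qed.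

End Illumination.

Theorem theorem1p2 (R : realType) (n : nat) (K : set 'rV[R]_n) (D : R)
  (sigma : probability (borelRn R n) R) (u : 'rV[R]_n)
  (hn : (2 <= n)%N)
  (hK : convex_body K)
  (hD : 1 < D)
  (hDK : eball D^-1 `<=` K)
  (hKB : K `<=` eball 1)
  (hsigma : sphere_haar sigma)
  (hu : esphere u) :
  (illumination_number K <=
    ((n%:R * ln n%:R + n%:R * ln (ln n%:R) + 5 * n%:R)
       / Omega sigma u (asin (D^-1)))%:E)%E.
Proof.
have [cK _ _] := hK.
have D0 : 0 < D by lra.
have rho0 : 0 < D^-1 by rewrite invr_gt0.
have rho1 : D^-1 < 1 by rewrite invf_lt1.
have alpha_pi : asin D^-1 < pi / 2 by apply: asin_ltpi2; lra.
have alpha0 : 0 < asin D^-1 by apply: asin_gt0; rewrite rho0 ltW.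
have [a [b [a0 b0 ab b2 hbound]]] := @covering_parameters R n hn.
have halpha : 0 < asin D^-1 < pi / 2 by rewrite alpha0.
have [s [sS scov ssize]] := sphere_covering hn hsigma hu halpha a0 b0 ab b2.
have m0 : 0 < mass sigma (cap u (asin D^-1)).
  by apply: mass_cap_gt0 => //; have := @pi_gt0 R; lra.
apply: (@le_trans _ _ (size s)%:R%:E); last first.
  rewrite lee_fin; apply: le_trans ssize _.
  by rewrite ler_pM2r ?invr_gt0.
apply: illumination_number_le => // c cb.
have c1 := boundary_unit_ball cK hKB cb.
have c0 : c != 0.
  apply/eqP => cE; case: cb => _; apply; rewrite cE.
  apply: (interior_of_eball rho0 hDK).
  by rewrite -(scale0r 0) dotpZl mul0r exprn_gt0.
have hc : esphere (- ((enorm c)^-1 *: c)).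
  apply/esphereP; have /esphereP := normalize_esphere c0.
  by rewrite dotpNl dotpNr opprK.
have [v vs vc] := scov _ hc; exists v => //.
apply: (illuminates_cap _ hDK) => //; last exact: sS.
by rewrite rho0 ltW.
Qed.
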